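(* Let $A$ be a discrete, torsion-free abelian group such that $Ext_{tfu}(A,X)=0$ for all groups $X\in\ell$. Then $A\cong\left(\bigoplus_{\sigma}\mathbb{Z}\right)\oplus D$ for some cardinal number $\sigma$ and some discrete, torsion-free, divisible group $D$.
   Context: All groups are Hausdorff topological abelian groups, written additively. $\ell$ is the category of locally compact abelian (LCA) groups with continuous homomorphisms as morphisms. A morphism is proper if it is open onto its image. An extension of $A$ by $C$ in $\ell$ is a short exact sequence $0\to A\stackrel{\phi}{\to}B\stackrel{\psi}{\to}C\to 0$ in $\ell$ in which $\phi$ and $\psi$ are proper morphisms. For a group $G$, $G^{(1)}=\bigcap_{n\ge 1}nG$ is the first Ulm subgroup, and $\overline{S}$ denotes the closure of $S$. Such an extension is a $TFU$ extension if $0\to\overline{A^{(1)}}\stackrel{\overline{\phi}}{\to}\overline{B^{(1)}}\stackrel{\overline{\psi}}{\to}\overline{C^{(1)}}\to 0$ is an extension, where $\overline{\phi}=\phi|_{\overline{A^{(1)}}}$ and $\overline{\psi}=\psi|_{\overline{B^{(1)}}}$. Two extensions $0\to A\stackrel{\phi_1}{\to}B\stackrel{\psi_1}{\to}C\to 0$ and $0\to A\stackrel{\phi_2}{\to}X\stackrel{\psi_2}{\to}C\to 0$ are equivalent if there is a topological isomorphism $\beta:B\to X$ with $\beta\phi_1=\phi_2$ and $\psi_2\beta=\psi_1$. An extension splits if it is equivalent to the trivial extension $0\to A\to A\oplus C\to C\to 0$. $Ext_{tfu}(C,A)$ is the class of all equivalence classes of $TFU$ extensions of $A$ by $C$, and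 $Ext_{tfu}(C,A)=0$ means that every $TFU$ extension of $A$ by $C$ splits. $G$ is divisible if $nG=G$ for every positive integer $n$. $\bigoplus_{\sigma}\mathbb{Z}$ is the (discrete) direct sum of $\sigma$ copies of $\mathbb{Z}$. *)

(* Defs.v *)
From HB Require Import structures.
From mathcomp Require Import all_boot all_order all_algebra.
From mathcomp Require Import all_classical topology tvs.
From mathcomp Require Import monalg.

Set Implicit Arguments.
Unset Strict Implicit.
Unset Printing Implicit Defensive.

Import GRing.Theory.

Local Open Scope classical_set_scope.
Local Open Scope ring_scope.

(** Topological abelian groups are the library's [topologicalZmodType], which
    does not include separation: being Hausdorff is part of [lca]. *)

Definition lca (G : topologicalZmodType) : Prop :=
  hausdorff_space G /\ locally_compact [set: G].

Definition discrete_group (G : topologicalZmodType) : Prop :=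
  forall U : set G, open U.

Definition torsion_free (G : zmodType) : Prop :=
  forall (x : G) (n : nat), (0 < n)%N -> x *+ n = 0 -> x = 0.

Definition multiples (G : zmodType) (n : nat) : set G :=
  range (fun x : G => x *+ n).
Arguments multiples : clear implicits.

Definition divisible (G : zmodType) : Prop :=
  forall n : nat, (0 < n)%N -> multiples G n = [set: G].

Definition ulm1 (G : zmodType) : set G :=
  \bigcap_(n in [set n | (0 < n)%N]) multiples G n.
Arguments ulm1 : clear implicits.

Record hom (A B : topologicalZmodType) := Hom {
  hom_fun :> {additive A -> B};
  hom_continuous : continuous hom_fun }.

(** Open onto the image, the image carrying the topology induced by [B]. *)
Definition proper_hom (A B : topologicalZmodType) (f : hom A B) : Prop :=
  forall U : set A, open U ->
    exists2 V : set B, open V & f @` U = V `&` range f.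

Definition extension (A B C : topologicalZmodType)
    (phi : hom A B) (psi : hom B C) : Prop :=
  [/\ [/\ lca A, lca B & lca C],
      [/\ injective phi, range phi = [set b | psi b = 0]
        & range psi = [set: C]]
    & proper_hom phi /\ proper_hom psi].

Definition top_iso (A B : topologicalZmodType) (f : hom A B) : Prop :=
  exists g : hom B A, cancel f g /\ cancel g f.

Definition top_isomorphic (A B : topologicalZmodType) : Prop :=
  exists f : hom A B, top_iso f.

Definition equivalent_ext (A B X C : topologicalZmodType)
    (phi1 : hom A B) (psi1 : hom B C)
    (phi2 : hom A X) (psi2 : hom X C) : Prop :=
  exists beta : hom B X, [/\ top_iso beta,
    forall a, beta (phi1 a) = phi2 a & forall b, psi2 (beta b) = psi1 b].

(** The library makes a product a topological group only when the factors are
    topological vector spaces, hence this alias of [A * C]. *)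
Section DirectSum.
Variables A C : topologicalZmodType.

Definition dsum : Type := (A * C)%type.

HB.instance Definition _ := Topological.copy dsum (A * C)%type.
HB.instance Definition _ := GRing.Zmodule.copy dsum (A * C)%type.

Lemma dsum_sub_continuous : continuous (fun x : dsum * dsum => x.1 - x.2).
Proof.
move=> x.
have cP (T : topologicalZmodType) (p : dsum -> T) : continuous p ->
    (fun y : dsum * dsum => p y.1 - p y.2) @ x --> p x.1 - p x.2.
  move=> cp; apply: (@continuous_comp _ _ _
    (fun y : dsum * dsum => (p y.1, p y.2)) (fun z : T * T => z.1 - z.2)).
    apply: cvg_pair; apply: (continuous_comp _ (cp _)).
      exact: cvg_fst.
    exact: cvg_snd.
  exact: sub_continuous.
apply: (cvg_pair (cP A fst _) (cP C snd _)) => y; [exact: cvg_fst|exact: cvg_snd].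
Qed.

HB.instance Definition _ :=
  PreTopologicalNmodule_isTopologicalZmodule.Build dsum dsum_sub_continuous.

Definition dsum_inl (a : A) : dsum := (a, 0).
Definition dsum_snd (x : dsum) : C := x.2.

Lemma dsum_inl_additive : zmod_morphism dsum_inl.
Proof. by move=> a b; congr pair; rewrite /= subr0. Qed.

HB.instance Definition _ :=
  GRing.isZmodMorphism.Build A dsum dsum_inl dsum_inl_additive.

Lemma dsum_snd_additive : zmod_morphism dsum_snd.
Proof. by []. Qed.

HB.instance Definition _ :=
  GRing.isZmodMorphism.Build dsum C dsum_snd dsum_snd_additive.

Lemma dsum_inl_continuous : continuous dsum_inl.
Proof. by move=> a; apply: cvg_pair; [exact: cvg_id|exact: cvg_cst]. Qed.

Lemma dsum_snd_continuous : continuous dsum_snd.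
Proof. by move=> x; exact: cvg_snd. Qed.

Definition dsum_inl_hom : hom A dsum := Hom dsum_inl_continuous.
Definition dsum_snd_hom : hom dsum C := Hom dsum_snd_continuous.

End DirectSum.

Definition splits (A B C : topologicalZmodType)
    (phi : hom A B) (psi : hom B C) : Prop :=
  equivalent_ext phi psi (dsum_inl_hom A C) (dsum_snd_hom A C).

(** The closure of the first Ulm subgroup, as a topological group with the
    topology induced by [G]. *)
Section ClosedUlm.
Variable G : topologicalZmodType.

Lemma ulm1_0 : ulm1 G 0.
Proof. by move=> n _; exists 0 => //; rewrite mul0rn. Qed.

Lemma ulm1_sub x y : ulm1 G x -> ulm1 G y -> ulm1 G (x - y).
Proof.
move=> ux uy n n0; have [a _ <-] := ux n n0; have [b _ <-] := uy n n0.
by exists (a - b) => //; rewrite mulrnBl.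
Qed.

Lemma closed_ulm_zmod_closed : zmod_closed (mem (closure (ulm1 G))).
Proof.
split=> [|x y]; rewrite !inE; first by apply: subset_closure; exact: ulm1_0.
move=> cx cy U /(@sub_continuous G (x, y)) [[V W] /= [Vx Wy] VWU].
have [a [ua Va]] := cx _ Vx; have [b [ub Wb]] := cy _ Wy.
by exists (a - b); split; [exact: ulm1_sub|exact: (VWU (a, b))].
Qed.

Definition closed_ulm : Type := set_type (closure (ulm1 G)).

HB.instance Definition _ := Topological.copy closed_ulm _.
HB.instance Definition _ := SubChoice.on closed_ulm.
HB.instance Definition _ :=
  GRing.SubChoice_isSubZmodule.Build G _ closed_ulm closed_ulm_zmod_closed.

Definition closed_ulm_val (x : closed_ulm) : G := \val x.

Lemma closed_ulm_valP x : closure (ulm1 G) (closed_ulm_val x).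
Proof. by have := valP x; rewrite inE. Qed.

Lemma closed_ulm_val_continuous : continuous closed_ulm_val.
Proof. exact: initial_continuous. Qed.

Lemma continuous_to_closed_ulm (T : topologicalType) (f : T -> closed_ulm) :
  continuous (closed_ulm_val \o f) -> continuous f.
Proof. by move=> cf; apply: continuous_comp_initial. Qed.

Lemma closed_ulm_sub_continuous :
  continuous (fun x : closed_ulm * closed_ulm => x.1 - x.2).
Proof.
apply: continuous_to_closed_ulm => x.
rewrite (_ : _ \o _ = (fun z : G * G => z.1 - z.2) \o
  (fun y => (closed_ulm_val y.1, closed_ulm_val y.2))); last first.
  by apply/funext => y /=; rewrite /closed_ulm_val raddfB.
apply: continuous_comp; last exact: sub_continuous.
by apply: cvg_pair; apply: continuous_comp;
  [exact: cvg_fst | exact: closed_ulm_val_continuous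
  |exact: cvg_snd | exact: closed_ulm_val_continuous].
Qed.

HB.instance Definition _ := PreTopologicalNmodule_isTopologicalZmodule.Build
  closed_ulm closed_ulm_sub_continuous.

End ClosedUlm.

Section Restriction.
Variables (A B : topologicalZmodType) (f : hom A B).

Lemma hom_closed_ulm (x : closed_ulm A) : f (\val x) \in closure (ulm1 B).
Proof.
rewrite inE => U /(@hom_continuous _ _ f _) nU.
have [a [ua Ua]] := @closed_ulm_valP _ x _ nU; exists (f a); split=> // n n0.
by have [b _ <-] := ua n n0; exists (f b) => //; rewrite raddfMn.
Qed.

Definition closed_ulm_fun (x : closed_ulm A) : closed_ulm B :=
  Sub (f (\val x)) (hom_closed_ulm x).

Lemma closed_ulm_fun_additive : zmod_morphism closed_ulm_fun.
Proof. by move=> x y; apply: val_inj; rewrite /= !raddfB. Qed.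

HB.instance Definition _ := GRing.isZmodMorphism.Build
  (closed_ulm A) (closed_ulm B) closed_ulm_fun closed_ulm_fun_additive.

Lemma closed_ulm_fun_continuous : continuous closed_ulm_fun.
Proof.
apply: continuous_to_closed_ulm => x.
rewrite (_ : _ \o _ = f \o @closed_ulm_val A); last first.
  by apply/funext => y /=; rewrite /closed_ulm_val SubK.
apply: continuous_comp; first exact: closed_ulm_val_continuous.
exact: hom_continuous.
Qed.

Definition closed_ulm_hom : hom (closed_ulm A) (closed_ulm B) :=
  Hom closed_ulm_fun_continuous.

End Restriction.

Definition tfu_extension (A B C : topologicalZmodType)
    (phi : hom A B) (psi : hom B C) : Prop :=
  extension phi psi /\ extension (closed_ulm_hom phi) (closed_ulm_hom psi).

(** [ext_tfu_trivial C A] is [Ext_tfu(C, A) = 0], about the extensions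
    0 -> A -> B -> C -> 0: the quotient group comes first. *)
Definition ext_tfu_trivial (C A : topologicalZmodType) : Prop :=
  forall (B : topologicalZmodType) (phi : hom A B) (psi : hom B C),
    tfu_extension phi psi -> splits phi psi.

Section DiscreteTopology.
Variable V : zmodType.

HB.instance Definition _ := GRing.Zmodule.copy (discrete_topology V) V.

Lemma discrete_topology_sub_continuous : continuous
  (fun x : discrete_topology V * discrete_topology V => x.1 - x.2).
Proof.
move=> [x y] U /nbhs_singleton Uxy.
by exists ([set x], [set y]);
  [split; exact: discrete_set1 | move=> [a b] /= [-> ->]].
Qed.

HB.instance Definition _ := PreTopologicalNmodule_isTopologicalZmodule.Build
  (discrete_topology V) discrete_topology_sub_continuous.

End DiscreteTopology.

(** [{malg int[I]}] consists of the finitely supported functions [I -> int]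
    with pointwise addition. *)
Definition free_abelian (I : choiceType) : topologicalZmodType :=
  discrete_topology {malg int[I]}.

(* Main.v *)
(** Cover [A] by [F + D], with [F] free abelian on [A] and [D = A^(1)]; as [A]
    is torsion-free, [D] is divisible, so [D] is also the first Ulm subgroup of
    [F + D], and that of the kernel is trivial.  The cover is thus a TFU
    extension, hence it splits; the [F]-component of a section is a
    homomorphism [A -> F] with kernel [D].  Its image is a subgroup of a free
    abelian group, hence free, and [A] is the sum of [D] and of this image. *)

Require Import Defs.
From HB Require Import structures.
From mathcomp Require Import all_boot all_order all_algebra.
From mathcomp Require Import all_classical topology tvs.
From mathcomp Require Import finmap wochoice monalg.

Set Implicit Arguments.
Unset Strict Implicit.
Unset Printing Implicit Defensive.

(* [Defs] once more, since the [hom] of all_algebra shadows the one of [Defs]. *)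
Import Defs GRing.Theory.

Local Open Scope classical_set_scope.
Local Open Scope ring_scope.

(** * Homomorphisms out of free abelian groups; subgroups of the integers *)

Section LinearExtension.
Variables (I : choiceType) (V : zmodType) (x : I -> V).

Definition lin_ext (f : {malg int[I]}) : V := \sum_(i <- msupp f) x i *~ f@_i.

(** The extra terms have coefficient zero; sums for several elements can thus run over one common
    support. *)
Lemma lin_extEw (S : {fset I}) f : (msupp f `<=` S)%fset ->
  lin_ext f = \sum_(i <- S) x i *~ f@_i.
Proof.
by move=> fS; apply: big_fset_incl => // i _ /mcoeff_outdom ->; rewrite mulr0z.
Qed.

Lemma lin_ext_additive : zmod_morphism lin_ext.
Proof.
move=> f g; set S := (msupp f `|` msupp g)%fset.
rewrite (@lin_extEw S (f - g)) ?msuppB_le// (@lin_extEw S f) ?fsubsetUl//.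
rewrite (@lin_extEw S g) ?fsubsetUr// -sumrB.
by apply: eq_bigr => i _; rewrite mcoeffB mulrzBr.
Qed.

HB.instance Definition _ :=
  GRing.isZmodMorphism.Build {malg int[I]} V lin_ext lin_ext_additive.

Lemma lin_extU n i : lin_ext << n *g i >> = x i *~ n.
Proof.
by rewrite (lin_extEw msuppU_le) big_seq_fset1 mcoeffUU.
Qed.

End LinearExtension.

(** Division by a nonzero element of least absolute value leaves remainder 0; the zero subgroup is
    generated by 0. *)
Lemma int_subgroup_principal (P : set int) :
    P 0 -> (forall m n, P m -> P n -> P (m - n)) ->
  exists2 d, P d & forall n, P n -> exists z, n = d * z.
Proof.
move=> P0 PB.
have PM d z : P d -> P (d * z).
  move=> Pd; have PN m : P m -> P (- m) by rewrite -(sub0r m); exact: PB.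
  have PMn k : P (d *+ k).
    by elim: k => // k IH; rewrite mulrSr -{2}[d]opprK; apply/PB/PN.
  case: z => k; first by rewrite -mulrzz -pmulrn.
  by rewrite NegzE mulrN -mulrzz -pmulrn; exact: PN.
have [[n [Pn n0]]|nP] := pselect (exists n, P n /\ n != 0); last first.
  exists 0 => // n Pn; exists 0; rewrite mulr0; apply/eqP/negP => /negP n0.
  by apply: nP; exists n.
pose Q k := `[< exists m : int, [/\ P m, m != 0 & `|m|%N = k] >].
have exQ : exists k, Q k by exists `|n|%N; apply/asboolP; exists n.
case: (ex_minnP exQ) => _ /asboolP[d [Pd d0 <-]] dmin; exists d => // m Pm.
exists (m %/ d)%Z; rewrite {1}(divz_eq m d) mulrC -[RHS]addr0; congr (_ + _).
apply/eqP/negPn/negP => md.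
have: (`|d| <= `|(m %% d)%Z|)%N.
  apply: dmin; apply/asboolP; exists (m %% d)%Z; split => //.
  by rewrite /modz mulrC; apply: PB => //; exact: PM.
by rewrite leqNgt -ltz_nat gez0_abs ?modz_ge0// abszE ltz_mod.
Qed.

(** * Well-orders, leading terms and subgroups of free abelian groups *)

Section WellOrder.
Variables (I : eqType) (R : rel I).
Hypothesis Rwo : well_order R.

Let Rchain : wo_chain R predT. Proof. by move=> A _; exact: Rwo. Qed.

Lemma wo_refl i : R i i. Proof. exact: (wo_chain_reflexive Rchain). Qed.

Lemma wo_anti i j : R i j -> R j i -> i = j.
Proof. by move=> ij ji; apply: (wo_chain_antisymmetric Rchain) => //; apply/andP. Qed.

Lemma wo_total i j : R i j || R j i.
Proof. exact: (wo_chainW Rchain). Qed.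

Lemma wo_ind (P : I -> Prop) :
  (forall i, (forall j, R j i -> j != i -> P j) -> P i) -> forall i, P i.
Proof.
move=> step i; apply: contrapT => nPi.
have [|j [[/asboolP nPj jmin] _]] := Rwo (A := [pred i | `[< ~ P i >]]).
  by exists i; apply/asboolP.
apply: nPj; apply: step => k kj; apply: contraNP => nPk.
by apply/eqP/wo_anti => //; apply/jmin/asboolP.
Qed.

(** The least of [i], [j], [k] is [i], or else antisymmetry makes two of them equal. *)
Lemma wo_trans i j k : R i j -> R j k -> R i k.
Proof.
move=> ij jk.
have [|m [[]]] := Rwo (A := [pred l | l \in [:: i; j; k]]).
  by exists i; rewrite !inE eqxx.
rewrite !inE => /or3P[] /eqP -> mmin _.
- by apply: mmin; rewrite !inE eqxx !orbT.
- have /(wo_anti ij) -> // : R j i by apply: mmin; rewrite !inE eqxx.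
- have /(wo_anti jk) <- // : R k j by apply: mmin; rewrite !inE eqxx orbT.
Qed.

Lemma wo_max_seq (s : seq I) : s != [::] ->
  exists2 i, i \in s & forall j, j \in s -> R j i.
Proof.
elim: s => // i [|j s] IH _.
  by exists i; rewrite ?mem_head// => j; rewrite inE => /eqP ->; exact: wo_refl.
have [//|m ms mmax] := IH; have [im|mi] := orP (wo_total i m).
  exists m => [|k]; first by rewrite inE ms orbT.
  by rewrite inE => /predU1P[->|/mmax].
exists i => [|k]; first exact: mem_head.
rewrite inE => /predU1P[->|/mmax km]; [exact: wo_refl|exact: wo_trans mi].
Qed.

(** A leading term exists because the support is finite. The map [h] allows a basis indexed by a
    subtype of [I]. *)
Lemma malg_lead (G : zmodType) (K : choiceType) (h : K -> I) (f : {malg G[K]}) :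
  f != 0 -> exists2 k, f@_k != 0 & forall l, f@_l != 0 -> R (h l) (h k).
Proof.
move=> f0; have [|_ /mapP[k kf ->] kmax] := @wo_max_seq [seq h k | k <- msupp f].
  apply: contraNneq f0 => /(congr1 size); rewrite size_map => /size0nil f0.
  apply/eqP/malgP => k; rewrite mcoeff0; apply: mcoeff_outdom.
  by rewrite -[_ \in _]/(k \in (msupp f : seq K)) f0.
exists k; rewrite ?mcoeff_neq0// => l; rewrite mcoeff_neq0 => lf.
by apply/kmax/map_f.
Qed.

End WellOrder.

(* The proof that subgroups of free abelian groups are free, applied to the
   image of [p]: along a well-order of [I], choose for each [i] an element of
   [A] whose image has support bounded by [i] and whose coefficient at [i]
   generates the group of all such coefficients.  Those with a nonzero
   coefficient map to a basis. *)
Lemma free_complement_kernel (A : zmodType) (I : choiceType)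
    (p : {additive A -> {malg int[I]}}) :
  exists (J : choiceType) (x : J -> A),
    (forall f, p (lin_ext x f) = 0 -> f = 0) /\
    (forall a, exists f, p (a - lin_ext x f) = 0).
Proof.
have [R Rwo] := well_ordering_principle I.
pose below i a := forall j, (p a)@_j != 0 -> R j i.
have belowB i a b : below i a -> below i b -> below i (a - b).
  move=> ai bi j; rewrite raddfB mcoeffB.
  have [a0|/ai//] := eqVneq ((p a)@_j) 0.
  by rewrite a0 sub0r oppr_eq0 => /bi.
have belowM i a n : below i a -> below i (a *~ n).
  move=> ai j; rewrite raddfMz.
  have -> : ((p a) *~ n)@_j = (p a)@_j *~ n by rewrite raddfMz.
  by move=> an0; apply: ai; apply: contraNneq an0 => ->; rewrite mul0rz.
have below0 i : below i 0 by move=> j; rewrite raddf0 mcoeff0 eqxx.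
have gen i : exists x, below i x /\
    forall a, below i a -> exists z, (p a)@_i = (p x)@_i * z.
  have [||d [x xi <-] xgen] := @int_subgroup_principal
      [set (p a)@_i | a in below i].
  - by exists 0; rewrite ?raddf0 ?mcoeff0.
  - move=> _ _ [a ai <-] [b bi <-]; exists (a - b); first exact: belowB.
    by rewrite raddfB mcoeffB.
  by exists x; split => // a ai; apply: xgen; exists a.
have [x xP] := choice gen.
pose J : choiceType := {i : I | (p (x i))@_i != 0}.
pose y (j : J) := x (val j); exists J, y; split=> [f|a].
  (* At the leading index [j] of [f] only the term of [j] contributes: the image of any other [y k]
     is bounded by [val k], strictly below [val j]. The coefficient there is a product of two
     nonzero integers. *)
  apply: contra_eq => f0; have [j fj jmax] := malg_lead Rwo val f0.
  have pf : (p (lin_ext y f))@_(val j) = (p (y j))@_(val j) *~ f@_j.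
    rewrite /lin_ext !raddf_sum/= (big_fsetD1 j) ?mcoeff_neq0//=.
      rewrite big1_fset ?addr0 => [|k]; first by rewrite !raddfMz.
      rewrite !inE => /andP[kj]; rewrite -mcoeff_neq0 => fk _.
      rewrite !raddfMz/=; have [->|pk] := eqVneq ((p (y k))@_(val j)) 0.
        by rewrite mul0rz.
      case/eqP: kj; apply/val_inj/(wo_anti Rwo (jmax _ fk)).
      exact: (xP (val k)).1.
    by rewrite -mcoeff_neq0.
  apply: contraNneq (valP j) => pf0; move: pf; rewrite pf0 mcoeff0.
  by move/esym/eqP; rewrite mulrz_eq0 (negPf fj).
have [pa0|pa0] := eqVneq (p a) 0; first by exists 0; rewrite raddf0 subr0.
(* Induction on a bound [i] for the support of [p a], initially its leading index. *)
have {pa0}[i _] := malg_lead Rwo id pa0; move: i a.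
apply: (wo_ind Rwo) => i IH a ai.
(* A multiple of [x i] cancels the coefficient at [i]; if the generator of these coefficients is 0,
   there is nothing to cancel. *)
have [f [fi fa]] : exists f, below i (lin_ext y f) /\ (p (a - lin_ext y f))@_i = 0.
  have [z az] := (xP i).2 a ai.
  have [xi|xi] := eqVneq ((p (x i))@_i) 0.
    by exists 0; split; rewrite raddf0 // subr0 az xi mul0r.
  exists << z *g (Sub i xi : J) >>; rewrite lin_extU; split.
    by apply: belowM; exact: (xP i).1.
  by rewrite raddfB raddfMz mcoeffB raddfMz /= az -mulrzz subrr.
have [b0|b0] := eqVneq (p (a - lin_ext y f)) 0; first by exists f.
(* The remainder is still bounded by [i] but vanishes at [i], so its leading index is strictly
   smaller. *)
have [j bj jmax] := malg_lead Rwo id b0.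
have ji : R j i by apply: belowB bj.
have [|g gP] := IH j ji _ _ jmax; first by apply: contraNneq bj => ->; rewrite fa.
by exists (f + g); rewrite (raddfD (lin_ext y)) opprD addrA.
Qed.

(** * Discrete topological groups and their extensions *)

Lemma discrete_nbhs (T : topologicalZmodType) : discrete_group T ->
  forall x : T, nbhs x [set x].
Proof. by move=> dT x; exact: (open_nbhs_nbhs (conj (dT _) erefl)). Qed.

Lemma closure_discrete (T : topologicalZmodType) : discrete_group T ->
  forall S : set T, closure S = S.
Proof.
move=> /discrete_nbhs dT S; apply/seteqP; split=> [x cx|]; last exact: subset_closure.
by have [y [Sy <-]] := cx _ (dT x).
Qed.

Lemma discrete_lca (T : topologicalZmodType) : discrete_group T -> lca T.
Proof.
move=> dT; have nT := discrete_nbhs dT; split=> [x y cxy|x _].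
  by have [z [<- <-]] := cxy _ _ (nT x) (nT y).
rewrite withinET; exists [set x] => //; split; first exact: compact_set1.
by rewrite /closed closure_discrete.
Qed.

Lemma discrete_closed_ulm (T : topologicalZmodType) :
  discrete_group T -> discrete_group (closed_ulm T).
Proof.
move=> dT U; exists (@closed_ulm_val T @` U) => //.
apply/seteqP; split=> [x /= [y Uy /val_inj <-]//|x Ux]; by exists x.
Qed.

Lemma closed_ulm_val_ulm1 (T : topologicalZmodType) : discrete_group T ->
  forall x : closed_ulm T, ulm1 T (val x).
Proof.
move=> dT x; have := @closed_ulm_valP T x; rewrite /closed_ulm_val; move: (\val x) => y.
by rewrite closure_discrete.
Qed.

Lemma discrete_topology_discrete (V : zmodType) :
  discrete_group (discrete_topology V).
Proof.
move=> U; rewrite openE => x Ux.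
by apply: (filterS _ (@discrete_set1 (discrete_topology V) x)) => _ ->.
Qed.

Lemma discrete_dsum (A C : topologicalZmodType) :
  discrete_group A -> discrete_group C -> discrete_group (dsum A C).
Proof.
move=> dA dC U; rewrite openE => -[a c] Uac.
exists ([set a], [set c]); first by split; exact: discrete_nbhs.
by move=> [a' c'] /= [-> ->].
Qed.

Lemma discrete_continuous (A B : topologicalZmodType) (f : A -> B) :
  discrete_group A -> continuous f.
Proof.
move=> dA x U fU; apply: filterS (discrete_nbhs dA x) => _ ->.
exact: (nbhs_singleton fU).
Qed.

Lemma proper_discrete (A B : topologicalZmodType) (f : hom A B) :
  discrete_group B -> proper_hom f.
Proof.
move=> dB U _; exists (f @` U) => //.
by apply/seteqP; split=> [_ [x Ux <-]|x []//]; split; [exists x|exists x].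
Qed.

Lemma top_isomorphic_discrete (A B : topologicalZmodType) (f : {additive A -> B}) :
  discrete_group A -> discrete_group B -> injective f -> range f = [set: B] ->
  top_isomorphic B A.
Proof.
move=> dA dB finj fsurj.
have [g gK] : exists g, cancel g f.
  suff /choice[g gP] : forall b, exists a, f a = b by exists g.
  by move=> b; have [a _ <-] : range f b; [rewrite fsurj|exists a].
have gB : zmod_morphism g by move=> a b; apply: finj; rewrite raddfB !gK.
pose gA := GRing.isZmodMorphism.Build B A g gB.
pose G : {additive B -> A} := HB.pack g gA.
exists (@Hom _ _ G (discrete_continuous dB)), (@Hom _ _ f (discrete_continuous dA)).
by split=> x; [exact: gK|apply: finj; exact: gK].
Qed.

Lemma extension_discrete (A B C : topologicalZmodType)
    (phi : hom A B) (psi : hom B C) :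
    discrete_group A -> discrete_group B -> discrete_group C ->
    injective phi -> range phi = [set b | psi b = 0] -> range psi = [set: C] ->
  extension phi psi.
Proof.
move=> dA dB dC; split; [by split; exact: discrete_lca|by []|].
by split; exact: proper_discrete.
Qed.

(** In discrete groups the Ulm subgroups are closed. Injectivity of [psi] on that of [B] forces that
    of [A] to vanish, so exactness in the middle only concerns 0. *)
Lemma tfu_extension_discrete (A B C : topologicalZmodType)
    (phi : hom A B) (psi : hom B C) :
    discrete_group A -> discrete_group B -> discrete_group C ->
    extension phi psi ->
    (forall b, ulm1 B b -> psi b = 0 -> b = 0) ->
    (forall c, ulm1 C c -> exists2 b, ulm1 B b & psi b = c) ->
  tfu_extension phi psi.
Proof.
move=> dA dB dC ext kerB surjB; split=> //.
have [_ [phi_inj phi_psi _] _] := ext.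
apply: extension_discrete; do ?exact: discrete_closed_ulm.
- by move=> x y /(congr1 val) /= /phi_inj /val_inj.
- apply/seteqP; split=> [_ [x _ <-]|b /(congr1 val) /= pb0].
    apply: (@val_inj _ _ (closed_ulm C)); rewrite raddf0 /=.
    suff : [set b | psi b = 0] (phi (val x)) by [].
    by rewrite -phi_psi; exists (val x).
  exists 0 => //; rewrite raddf0; apply/val_inj; rewrite raddf0; apply/esym/kerB => //.
  exact: closed_ulm_val_ulm1.
- apply/seteqP; split=> // c _.
  have [|b ub bc] := surjB (val c); first exact: closed_ulm_val_ulm1.
  have cb : b \in closure (ulm1 B) by apply/mem_set/subset_closure.
  by exists (Sub b cb) => //; apply/val_inj.
Qed.

(** If [x = n y] lies in the Ulm subgroup, then [x = n m z] for some [z], and cancelling [n] gives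
    [y = m z]; so [y] lies there too. *)
Lemma torsion_free_closed_ulm_divisible (A : topologicalZmodType) :
  discrete_group A -> torsion_free A -> divisible (closed_ulm A).
Proof.
move=> dA tA n n0; apply/seteqP; split=> // x _.
have ux := closed_ulm_val_ulm1 dA x.
have [y _ yx] := ux n n0.
have uy : y \in closure (ulm1 A).
  apply/mem_set; rewrite closure_discrete// => m m0.
  have [|z _ zx] := ux (n * m)%N; first by rewrite /= muln_gt0 n0.
  exists z => //; apply/eqP; rewrite -subr_eq0; apply/eqP/(tA _ n n0).
  by rewrite mulrnBl yx -mulrnA mulnC zx subrr.
by exists (Sub y uy) => //; apply/val_inj; rewrite raddfMn.
Qed.

(** * First Ulm subgroups of free abelian groups *)

Lemma ulm1_hom (A B : zmodType) (f : {additive A -> B}) a :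
  ulm1 A a -> ulm1 B (f a).
Proof. by move=> ua n /ua[b _ <-]; exists (f b) => //; rewrite raddfMn. Qed.

(** Such an [n] is a multiple of [|n| + 1], which exceeds its absolute value. *)
Lemma ulm1_int (n : int) : ulm1 int n -> n = 0.
Proof.
move=> /(_ `|n|.+1 isT)[m _ mn]; apply/eqP; rewrite -absz_eq0.
have [//|n0] := posnP `|n|%N.
have : (`|n|.+1 %| `|n|)%N.
  by rewrite -{2}mn pmulrn mulrzz abszM absz_nat dvdn_mull.
by move=> /(dvdn_leq n0); rewrite ltnn.
Qed.

Lemma ulm1_malg (I : choiceType) (f : {malg int[I]}) :
  ulm1 {malg int[I]} f -> f = 0.
Proof.
move=> uf; apply/malgP => i; rewrite mcoeff0; apply: ulm1_int.
exact: (ulm1_hom (mcoeff i)).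
Qed.

(** * The cover and its kernel *)

Section Kernel.
Variables (U V : zmodType) (f : {additive U -> V}).

Definition kernel : Type := {x : U | f x == 0}.

Lemma kernel_zmod_closed : zmod_closed [pred x | f x == 0].
Proof.
by split=> [|x y]; rewrite !inE ?raddf0// raddfB => /eqP-> /eqP->; rewrite subrr.
Qed.

HB.instance Definition _ := SubChoice.on kernel.
HB.instance Definition _ :=
  GRing.SubChoice_isSubZmodule.Build U _ kernel kernel_zmod_closed.

End Kernel.

Section FreeCover.
Variable A : topologicalZmodType.

(** The free summand makes the projection surjective; the second summand makes it surjective on Ulm
    subgroups, that of the free summand being zero. *)
Definition free_cover : Type := ({malg int[A]} * closed_ulm A)%type.
HB.instance Definition _ := GRing.Zmodule.on free_cover.

Definition free_cover_proj (x : free_cover) : A := lin_ext id x.1 + val x.2.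

Lemma free_cover_proj_additive : zmod_morphism free_cover_proj.
Proof.
by move=> x y; rewrite /free_cover_proj /= !raddfB /= opprD addrACA.
Qed.

HB.instance Definition _ := GRing.isZmodMorphism.Build
  free_cover A free_cover_proj free_cover_proj_additive.
End FreeCover.

Definition discrete_hom (V : zmodType) (B : topologicalZmodType)
    (f : {additive V -> B}) : hom (discrete_topology V) B :=
  @Hom (discrete_topology V) B f
    (discrete_continuous (@discrete_topology_discrete V)).

Lemma free_cover_kernel_tfu (A : topologicalZmodType) : discrete_group A ->
    torsion_free A ->
  tfu_extension
    (discrete_hom (val : {additive kernel (@free_cover_proj A) ->
                          discrete_topology (free_cover A)}))
    (discrete_hom (@free_cover_proj A)).
Proof.
move=> dA tA; have dD := discrete_closed_ulm dA.
have divD := torsion_free_closed_ulm_divisible dA tA.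
apply: tfu_extension_discrete => //; do ?exact: discrete_topology_discrete.
- apply: extension_discrete => //; do ?exact: discrete_topology_discrete.
  + apply/seteqP; split=> [_ [x _ <-]|b /eqP b0]; first exact/eqP/(valP x).
    by exists (Sub b b0 : kernel _).
  + apply/seteqP; split=> // a _; exists (<< a >>, 0) => //=.
    by rewrite /free_cover_proj lin_extU raddf0 addr0.
(* The free component of an Ulm element is zero, and on the other summand the projection is the
   inclusion into [A]. *)
- move=> [f d] ufd /=; have /ulm1_malg -> : ulm1 {malg int[A]} f.
    exact: (ulm1_hom fst ufd).
  rewrite /free_cover_proj /= raddf0 add0r => d0; congr pair.
  by apply: val_inj; rewrite raddf0.
- move=> a ua; have ca : a \in closure (ulm1 A).
    by apply/mem_set/subset_closure.
  exists (0, Sub a ca); last by rewrite /= /free_cover_proj raddf0 add0r.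
  move=> n n0; have [d _ dn] : multiples (closed_ulm A) n (Sub a ca).
    by rewrite divD.
  exists (0, d) => //; apply: injective_projections.
    by rewrite (raddfMn fst) mul0rn.
  by rewrite (raddfMn snd).
Qed.

Theorem lemma3p5 (A : topologicalZmodType)
    (A_discrete : discrete_group A) (A_torsion_free : torsion_free A)
    (A_ext : forall X : topologicalZmodType, lca X -> ext_tfu_trivial A X) :
  exists (sigma : choiceType) (D : topologicalZmodType),
    [/\ discrete_group D, torsion_free D, divisible D
      & top_isomorphic A (dsum (free_abelian sigma) D)].
Proof.
have [|beta [[gamma [_ gammaK]] _ psi_beta]] := A_ext _ _ _ _ _
    (free_cover_kernel_tfu A_discrete A_torsion_free).
  by apply: discrete_lca; exact: discrete_topology_discrete.
(* The map sending [a] to [gamma (0, a)] is a section of the cover. *)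
pose p (a : A) : {malg int[A]} := (gamma (0, a) : free_cover A).1.
have pB : zmod_morphism p.
  move=> a b; rewrite /p -(raddfB fst) -raddfB; congr (gamma _).1.
  by congr pair; rewrite /= subrr.
pose pA := GRing.isZmodMorphism.Build A {malg int[A]} p pB.
pose P : {additive A -> {malg int[A]}} := HB.pack p pA.
(* If the free component of the section vanishes at [a], projecting back shows that [a] comes from
   [closed_ulm A]; conversely, a free group has no nonzero Ulm elements. *)
have p0 a : P a = 0 <-> ulm1 A a.
  split=> [pa0|/(ulm1_hom P)/ulm1_malg //].
  have <- : free_cover_proj (gamma (0, a)) = a.
    by rewrite -[LHS]psi_beta gammaK.
  rewrite /free_cover_proj [_.1]pa0 raddf0 add0r.
  exact: closed_ulm_val_ulm1.
have [J [x [x_inj x_gen]]] := free_complement_kernel P.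
have dF : discrete_group (dsum (free_abelian J) (closed_ulm A)).
  apply: discrete_dsum; first exact: discrete_topology_discrete.
  exact: discrete_closed_ulm.
exists J, (closed_ulm A); split.
- exact: discrete_closed_ulm.
- move=> d n n0 /(congr1 val); rewrite raddfMn raddf0 => /(A_torsion_free _ _ n0).
  by move=> d0; apply/val_inj; rewrite d0 raddf0.
- exact: torsion_free_closed_ulm_divisible.
pose f (y : dsum (free_abelian J) (closed_ulm A)) : A := lin_ext x y.1 + val y.2.
have fB : zmod_morphism f.
  by move=> y z; rewrite /f /= !raddfB /= opprD addrACA.
pose fA := GRing.isZmodMorphism.Build _ A f fB.
pose f' : {additive dsum (free_abelian J) (closed_ulm A) -> A} := HB.pack f fA.
apply: (@top_isomorphic_discrete _ _ f') => //.
(* As [P] kills [val d], applying it to the relation gives [P (lin_ext x g) = 0], hence [g = 0] and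
   then [d = 0]. *)
- apply: raddf_inj => -[g d] /= gd0; have g0 : g = 0.
    apply: x_inj; have /p0 d0 := closed_ulm_val_ulm1 A_discrete d.
    by rewrite -[LHS]addr0 -d0 -raddfD [_ + _]gd0 raddf0.
  rewrite g0 in gd0 *; congr pair; apply: val_inj.
  by rewrite raddf0 -gd0 /f raddf0 add0r.
- apply/seteqP; split=> // a _.
  have [g /p0 ug] := x_gen a.
  have cg : a - lin_ext x g \in closure (ulm1 A) by apply/mem_set/subset_closure.
  by exists (g, Sub (a - lin_ext x g) cg) => //=; rewrite /f /= addrC subrK.
Qed.
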